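(* Let $\lambda\vdash n$ be a Young diagram. Every Specht polynomial $SP_t$, for $t$ a tableau of shape $\lambda$, is an element of the space of forms $L_\lambda$; that is, $SP_\lambda\subset L_\lambda$.
   Context: Everything is over $\mathbb C$. Cells of $\lambda$ are denoted $(i,j)$, $i$ = row, $j$ = column; $\lambda_1$ is the length of the first row and $n'=n-\lambda_1$. The space $L_\lambda$: for $n'$ variables $y_{i,j}$ indexed by the cells $(i,j)$ of $\lambda$ with $i>1$, let $X_\lambda(\{y_{i,j}\})=\prod_{(i,j),\,i>1}y_{i,j}^{\,i-1}$. $L_\lambda\subset\mathbb C[x_1,\dots,x_n]$ is the linear span of all monomials obtained from $X_\lambda$ by substituting for the $y_{i,j}$ any $n'$ distinct variables chosen from $x_1,\dots,x_n$ (in any assignment). Specht polynomials: for a tableau $t$ of shape $\lambda$ (a bijective filling of the cells by $1,\dots,n$), place in the cell $(i,j)$ the variable $x_{t(i,j)}$. The Specht polynomial is $SP_t=\prod_j\prod_{s<k}(x_{t(s,j)}-x_{t(k,j)})$, where $j$ runs over the columns and $s<k$ over the pairs of row indices of cells in the $j$th column. The Specht module $SP_\lambda$ is the linear span of all polynomials obtained from $SP_t$ by permutations of the variables. *)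

(* Defs.v *)
From HB Require Import structures.
From mathcomp Require Import all_boot all_order all_algebra all_fingroup.
From mathcomp Require Import classical_sets reals complex mpoly.

Set Implicit Arguments.
Unset Strict Implicit.
Unset Printing Implicit Defensive.

Import GRing.Theory.
Local Open Scope ring_scope.
Local Open Scope classical_set_scope.

Definition is_partition (n : nat) (lam : seq nat) : bool :=
  [&& sorted geq lam, 0%N \notin lam & sumn lam == n].

(* Rows and columns are numbered from 0: the mathematical cell (i, j) is the
   one with row i - 1 and column j - 1. *)
Definition cell (lam : seq nat) : finType :=
  {i : 'I_(size lam) & 'I_(nth 0%N lam i)}.

Definition row_idx (lam : seq nat) (c : cell lam) : nat := tag c.

Definition col_idx (lam : seq nat) (c : cell lam) : nat := tagged c.

Definition lower_cell (lam : seq nat) : finType :=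
  {c : cell lam | (0 < row_idx c)%N}.

Definition lin_span (F : nzRingType) (V : lmodType F) (S : set V) : set V :=
  [set u | exists (m : nat) (a : 'I_m -> F) (v : 'I_m -> V),
     (forall k, S (v k)) /\ u = \sum_(k < m) a k *: v k].

(* The exponent i - 1 of the 1-based row i is the 0-based row index. *)
Definition X_mon (A : comNzRingType) (lam : seq nat)
    (y : lower_cell lam -> A) : A :=
  \prod_(c : lower_cell lam) y c ^+ row_idx (val c).

Definition L_space (F : comNzRingType) (n : nat) (lam : seq nat) :
    set {mpoly F[n]} :=
  lin_span [set p | exists f : lower_cell lam -> 'I_n,
    injective f /\ p = X_mon (fun c => 'X_(f c))].

Arguments L_space : clear implicits.

(* A tableau of shape lam is a bijection t : cell lam -> 'I_n; bijectivity is
   left as a hypothesis on t. *)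
Definition specht_poly (F : comNzRingType) (n : nat) (lam : seq nat)
    (t : cell lam -> 'I_n) : {mpoly F[n]} :=
  \prod_(j < head 0%N lam)
    \prod_(c : cell lam | col_idx c == j)
      \prod_(d : cell lam | (col_idx d == j) && (row_idx c < row_idx d)%N)
        ('X_(t c) - 'X_(t d)).

Definition specht_module (F : comNzRingType) (n : nat) (lam : seq nat)
    (t : cell lam -> 'I_n) : set {mpoly F[n]} :=
  lin_span [set p | exists s : 'S_n, p = msym s (specht_poly F t)].

Arguments specht_poly F {n lam} t.
Arguments specht_module F {n lam} t.

(* Main.v *)
Require Import Defs.
From HB Require Import structures.
From mathcomp Require Import all_boot all_order all_algebra all_fingroup.
From mathcomp Require Import classical_sets reals complex mpoly.

Set Implicit Arguments.
Unset Strict Implicit.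
Unset Printing Implicit Defensive.

Import GRing.Theory.
Local Open Scope ring_scope.
Local Open Scope classical_set_scope.

(** The factor of [SP_t] attached to one column is a Vandermonde product in the
    variables of that column.  Expanding the Vandermonde determinant writes it,
    up to signs, as a sum of monomials in which the variables of the column
    carry the exponents [0, 1, 2, ...], each exactly once: these are the row
    indices of the column, permuted among its cells
    ([lin_span_vandermonde]).  Multiplying over the columns, whose cells are
    disjoint, the permutations of the single columns combine into one
    permutation [s] of all the cells ([lin_spanM], [perm_monomialsM]), so
    [SP_t] is a combination of the monomials
    [\prod_c x_(t (s c)) ^ (row of c)].  The cells of the first row have
    exponent [0], hence such a monomial is [X_lambda] with the distinct
    variables [x_(t (s c))] substituted at the lower cells, a generator of
    [L_lambda].  The rows of a partition are weakly decreasing, so each column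
    occupies an initial segment of the rows ([columnE]); this is why the
    exponents of its Vandermonde determinant are its row indices.

    Permuting the variables of [SP_t] gives the Specht polynomial of another
    tableau of the same shape, which yields the inclusion of the Specht
    module. *)

(** * Linear spans *)

Section LinSpan.
Variables (F : nzRingType) (V : lmodType F).
Implicit Types (S : set V) (u v : V).

Lemma lin_span_gen S v : S v -> lin_span S v.
Proof.
move=> Sv; exists 1%N, (fun=> 1), (fun=> v).
by split=> //; rewrite big_ord1 scale1r.
Qed.

Lemma lin_span0 S : lin_span S 0.
Proof.
exists 0%N, (fun=> 0), (fun=> 0).
by split=> [[]|]; rewrite ?big_ord0.
Qed.

Lemma lin_spanD S u v : lin_span S u -> lin_span S v -> lin_span S (u + v).
Proof.
move=> [m [a [f [Sf ->]]]] [k [b [g [Sg ->]]]].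
exists (m + k)%N,
  (fun i => match fintype.split i with inl j => a j | inr j => b j end),
  (fun i => match fintype.split i with inl j => f j | inr j => g j end).
split=> [i|]; first by case: (fintype.split i).
rewrite big_split_ord /=.
congr (_ + _); apply: eq_bigr => i _.
  by rewrite (unsplitK (inl i)).
by rewrite (unsplitK (inr i)).
Qed.

Lemma lin_spanZ S a v : lin_span S v -> lin_span S (a *: v).
Proof.
move=> [m [b [f [Sf ->]]]]; exists m, (fun i => a * b i), f; split=> //.
by rewrite scaler_sumr; apply: eq_bigr => i _; rewrite scalerA.
Qed.

Lemma lin_spanN S v : lin_span S v -> lin_span S (- v).
Proof. by rewrite -scaleN1r; exact: lin_spanZ. Qed.

Lemma lin_span_sum S (I : Type) (r : seq I) (P : pred I) (f : I -> V) :
  (forall i, P i -> lin_span S (f i)) -> lin_span S (\sum_(i <- r | P i) f i).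
Proof.
move=> Sf; apply: (big_ind (lin_span S)) => //; first exact: lin_span0.
by move=> u v; exact: lin_spanD.
Qed.

Lemma lin_span_min S S' : S `<=` lin_span S' -> lin_span S `<=` lin_span S'.
Proof.
move=> SS' _ [m [a [f [Sf ->]]]].
by apply: lin_span_sum => i _; apply/lin_spanZ/SS'.
Qed.

End LinSpan.

Lemma lin_spanM (F : comNzRingType) (A : algType F) (S S' S'' : set A) :
  (forall u v, S u -> S' v -> S'' (u * v)) ->
  forall u v, lin_span S u -> lin_span S' v -> lin_span S'' (u * v).
Proof.
move=> SM _ _ [m [a [f [Sf ->]]]] [k [b [g [Sg ->]]]].
rewrite mulr_suml; apply: lin_span_sum => i _.
rewrite mulr_sumr; apply: lin_span_sum => j _.
rewrite -scalerAl -scalerAr; apply/lin_spanZ/lin_spanZ/lin_span_gen.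
exact: SM.
Qed.

Lemma lin_span_signM (F : nzRingType) (A : lalgType F) (S : set A) k v :
  lin_span S v -> lin_span S ((-1) ^+ k * v).
Proof.
by rewrite -signr_odd mulr_sign; case: ifP => // _; exact: lin_spanN.
Qed.

(** * Monomials with permuted exponents *)

Section PermMonomials.
Variables (F : comNzRingType) (A : comAlgType F).
Variables (T : finType) (x : T -> A) (w : T -> nat).
Implicit Types (C D : {set T}) (p q : A).

(** Using permutations of the whole of [T] that fix the complement of [C],
    rather than permutations of [C], lets monomials over different subsets be
    multiplied by composing permutations. *)
Definition perm_monomials C : set A :=
  [set p | exists s : {perm T},
     perm_on C s /\ p = \prod_(c in C) x (s c) ^+ w c].

(** Permutations supported on disjoint sets do not interfere, so their product
    permutes the exponents within each of the two sets as they do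
    separately. *)
Lemma perm_monomialsM C D p q : [disjoint C & D]%B ->
  perm_monomials C p -> perm_monomials D q ->
  perm_monomials (C :|: D)%SET (p * q).
Proof.
move=> dCD [s [Cs ->]] [r [Dr ->]]; exists (s * r)%g; split.
  apply: perm_onM.
    exact: fintype.subset_trans Cs (finset.subsetUl _ _).
  exact: fintype.subset_trans Dr (finset.subsetUr _ _).
rewrite [RHS](eq_bigl (mem [predU C & D])) => [|c]; last by rewrite !inE.
rewrite bigU //; congr (_ * _); apply: eq_bigr => c cE; rewrite permM.
  rewrite (out_perm Dr) //.
  by apply: negbT; apply: (disjointFr dCD); rewrite (perm_closed _ Cs).
by rewrite (out_perm Cs) // (disjointFl dCD cE).
Qed.

Lemma perm_extend (I : finType) (e : I -> T) (s : {perm I}) : injective e ->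
  exists r : {perm T}, perm_on (e @: I)%SET r /\
    forall i, r (e i) = e (s i).
Proof.
move=> e_inj.
pose f c := if [pick i | e i == c] is Some i then e (s i) else c.
have fe i : f (e i) = e (s i).
  by rewrite /f; case: pickP => [k /eqP/e_inj->|/(_ i)/=/eqP].
have fout c : c \notin (e @: I)%SET -> f c = c.
  rewrite /f; case: pickP => // i /eqP <-.
  by rewrite finset.imset_f ?inE.
have f_on c : (f c \in (e @: I)%SET) = (c \in (e @: I)%SET).
  have [/imsetP[i _ ->]|cN] := boolP (c \in (e @: I)%SET).
    by rewrite fe finset.imset_f ?inE.
  by rewrite fout // (negbTE cN).
have f_inj : injective f.
  move=> c d fcd; have := f_on c; rewrite fcd f_on.
  have [/imsetP[i _ ci]|cN] := boolP (c \in (e @: I)%SET).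
    move=> /imsetP[k _ dk]; move: fcd.
    by rewrite ci dk !fe => /e_inj/perm_inj->.
  by move=> /negbT dN; rewrite -(fout c) // -(fout d).
exists (perm f_inj); split=> [|i]; last by rewrite permE.
apply/fintype.subsetP => c; rewrite inE permE.
by apply: contraR => /fout->.
Qed.

(** Leibniz expansion of the Vandermonde determinant.  The determinant is taken
    at the points [- x c], which makes its factors [x c - x d] for
    [w c < w d], at the price of a sign in each monomial. *)
Lemma lin_span_vandermonde h (e : 'I_h -> T) :
    injective e -> (forall i, w (e i) = i) ->
  lin_span (perm_monomials (e @: 'I_h)%SET)
    (\prod_(c in (e @: 'I_h)%SET)
       \prod_(d in (e @: 'I_h)%SET | (w c < w d)%N) (x c - x d)).
Proof.
move=> e_inj we.
have e_inj' : {in 'I_h &, injective e} by exact: in2W.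
rewrite big_imset //=.
rewrite [X in lin_span _ X](_ : _ =
    \det (Vandermonde h (\row_i - x (e i)))); last first.
  rewrite det_Vandermonde; apply: eq_big => [i|i _]; first by rewrite inE.
  rewrite big_imset_cond //; apply: eq_big => [k|k _]; first by rewrite inE !we.
  by rewrite !mxE opprK addrC.
apply: lin_span_sum => s _; apply: lin_span_signM.
under eq_bigr do rewrite !mxE exprNn.
rewrite big_split /= -expr_sum; apply/lin_span_signM/lin_span_gen.
have [r [r_on re]] := perm_extend s e_inj.
exists r; split=> //; rewrite big_imset //=.
by apply: eq_big => [i|i _]; rewrite ?inE // re we.
Qed.

End PermMonomials.

(** * Columns of a Young diagram *)

Section Columns.
Variable lam : seq nat.
Hypothesis lam_sorted : sorted geq lam.

Definition column (j : nat) : {set cell lam} := [set c | col_idx c == j]%SET.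

(** The rows of length greater than [j] come first, so their number, which is
    the height of column [j], is the index of the first shorter row. *)
Definition col_height (j : nat) : nat := find (geq j) lam.

Lemma col_height_row j (i : 'I_(col_height j)) : (i < size lam)%N.
Proof. exact: leq_trans (ltn_ord i) (find_size _ _). Qed.

Lemma col_height_col j (i : 'I_(col_height j)) :
  (j < nth 0 lam (Ordinal (col_height_row i)))%N.
Proof.
rewrite ltnNge; apply/negbT.
exact: (@before_find _ 0%N (geq j) lam _ (ltn_ord i)).
Qed.

Definition col_cell j (i : 'I_(col_height j)) : cell lam :=
  Tagged (fun i : 'I_(size lam) => 'I_(nth 0%N lam i))
    (Ordinal (col_height_col i)).

Lemma row_col_cell j (i : 'I_(col_height j)) : row_idx (col_cell i) = i.
Proof. by []. Qed.

Lemma col_cell_inj j : injective (@col_cell j).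
Proof.
by move=> i k ik; apply/val_inj; rewrite -[LHS]row_col_cell ik.
Qed.

Lemma cell_eq (c d : cell lam) :
  row_idx c = row_idx d -> col_idx c = col_idx d -> c = d.
Proof.
case: c d => [i a] [k b] /val_inj/= ik; case: k / ik b => b ab.
by congr Tagged; exact: val_inj.
Qed.

Lemma row_length_le i k :
  (i <= k < size lam)%N -> (nth 0 lam k <= nth 0 lam i)%N.
Proof.
move=> /andP[ik k_lt].
have geq_trans : transitive geq by move=> a b d ba ad; apply: leq_trans ad ba.
apply: (sorted_leq_nth geq_trans leqnn 0%N lam_sorted) => //.
exact: leq_ltn_trans ik k_lt.
Qed.

Lemma columnE j : column j = (@col_cell j @: 'I_(col_height j))%SET.
Proof.
apply/setP=> c; rewrite inE; apply/eqP/imsetP => [cj|[i _ ->] //].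
have row_lt : (row_idx c < col_height j)%N.
  rewrite ltnNge; apply/negP => hc.
  have h_lt : (col_height j < size lam)%N.
    by apply: leq_ltn_trans hc (ltn_ord _).
  have : (nth 0 lam (col_height j) <= j)%N.
    by apply: (@nth_find _ 0%N (geq j)); rewrite has_find.
  rewrite leqNgt -{1}cj => /negP[]; apply: leq_trans (ltn_ord (tagged c)) _.
  by apply: row_length_le; apply/andP; split.
by exists (Ordinal row_lt) => //; exact: cell_eq.
Qed.

Lemma col_idx_lt c : (@col_idx lam c < head 0 lam)%N.
Proof.
rewrite -nth0; apply: leq_trans (ltn_ord (tagged c)) _.
by apply: row_length_le; rewrite ltn_ord.
Qed.

Section Product.
Variables (F : comNzRingType) (A : comAlgType F) (x : cell lam -> A).

(** The product is taken one column at a time, so that each new column is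
    disjoint from the cells already treated. *)
Lemma lin_span_columns k :
  lin_span (perm_monomials x (@row_idx lam) [set c | (col_idx c < k)%N]%SET)
    (\prod_(j < k) \prod_(c : cell lam | col_idx c == j)
       \prod_(d : cell lam | (col_idx d == j) && (row_idx c < row_idx d)%N)
         (x c - x d)).
Proof.
elim: k => [|k IHk].
  rewrite big_ord0; apply: lin_span_gen; exists 1%g; split.
    exact: perm_on1.
  by rewrite big_pred0 // => c; rewrite inE.
have -> : [set c : cell lam | (col_idx c < k.+1)%N]%SET =
    ([set c : cell lam | (col_idx c < k)%N] :|: column k)%SET.
  by apply/setP => c; rewrite !inE ltnS leq_eqVlt orbC.
have dis : [disjoint [set c : cell lam | (col_idx c < k)%N]%SET & column k]%B.
  rewrite -setI_eq0; apply/eqP/setP => c; rewrite !inE.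
  by case: ltngtP.
rewrite big_ord_recr /=.
apply: (lin_spanM (fun u v => perm_monomialsM dis)) IHk _.
rewrite columnE.
have := lin_span_vandermonde x (@col_cell_inj k) (@row_col_cell k).
rewrite -columnE //; congr lin_span.
apply: eq_big => [c|c _]; first by rewrite inE.
by apply: eq_bigl => d; rewrite inE.
Qed.

End Product.
End Columns.

(** * Specht polynomials *)

Lemma specht_poly_L_space (F : comNzRingType) n lam (t : cell lam -> 'I_n) :
  sorted geq lam -> injective t -> L_space F n lam (specht_poly F t).
Proof.
move=> lam_sorted t_inj.
have := lin_span_columns lam_sorted (fun c => 'X_(t c) : {mpoly F[n]})
  (head 0%N lam).
apply: lin_span_min => _ [s [_ ->]]; apply: lin_span_gen.
exists (fun c : lower_cell lam => t (s (val c))); split.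
  by move=> c d /t_inj/perm_inj/val_inj.
rewrite /X_mon.
have all_c (c : cell lam) :
    c \in [set c : cell lam | (col_idx c < head 0 lam)%N]%SET.
  by rewrite inE col_idx_lt.
(* The cells of the first row contribute the factor [_ ^+ 0]. *)
rewrite (bigID (fun c => 0 < row_idx c)%N) /=.
rewrite [X in _ * X]big1 ?mulr1; last first.
  by move=> c /andP[_]; rewrite -eqn0Ngt => /eqP->.
rewrite -[RHS](big_sub [pred c : cell lam | 0 < row_idx c]%N
  (fun c => 'X_(t (s c)) ^+ row_idx c)).
by apply: eq_bigl => c; rewrite all_c inE.
Qed.

Lemma msym_specht_poly (F : comNzRingType) n lam (t : cell lam -> 'I_n)
    (s : 'S_n) :
  msym s (specht_poly F t) = specht_poly F (fun c => s (t c)).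
Proof.
have msym_var i : msym s 'X_i = 'X_(s i) :> {mpoly F[n]}.
  rewrite msymX; congr 'X_[_]; apply/mnmP => k.
  rewrite !mnmE; congr (nat_of_bool _).
  by rewrite -(inj_eq (@perm_inj _ s)) permKV.
rewrite /specht_poly rmorph_prod; apply: eq_bigr => j _.
rewrite rmorph_prod; apply: eq_bigr => c _.
rewrite rmorph_prod; apply: eq_bigr => d _.
by rewrite rmorphB /= !msym_var.
Qed.

Theorem proposition4 (R : realType) (n : nat) (lam : seq nat)
    (hlam : is_partition n lam) :
  (forall t : cell lam -> 'I_n, bijective t ->
     L_space R[i] n lam (specht_poly R[i] t)) /\
  (forall t : cell lam -> 'I_n, bijective t ->
     specht_module R[i] t `<=` L_space R[i] n lam).
Proof.
have /and3P[lam_sorted _ _] := hlam.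
split=> t /bij_inj t_inj; first exact: specht_poly_L_space.
apply: lin_span_min => _ [s ->]; rewrite msym_specht_poly.
apply: specht_poly_L_space => //.
by move=> c d /perm_inj/t_inj.
Qed.
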